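(* There are constants $C$ and $C'$ such that the following holds. Let $b_{ij}$ ($1\le i\le j\le n$) be independent random variables, and let $K>0$ and $\sigma_{ij}\ge 0$ be numbers, such that $|b_{ij}|\le K$, $\mathrm{E}(b_{ij})=0$ and $\mathrm{Var}(b_{ij})\le\sigma_{ij}^2$ for all $1\le i\le j\le n$. Set $b_{ji}=b_{ij}$ and $\sigma_{ji}=\sigma_{ij}$, let $B=(b_{ij})_{i,j=1}^n$ be the resulting random symmetric matrix, and let $\Delta=\max_{1\le i\le n}\sum_{j=1}^n\sigma_{ij}^2$. If $\Delta\ge C'K^2\ln^4 n$, then almost surely $$\|B\|\le 2\sqrt{\Delta}+C\sqrt{K}\,\Delta^{1/4}\ln n.$$
   Context: $\|M\|$ denotes the spectral norm (largest singular value) of $M$. The random variables, $K$, $\sigma_{ij}$ and $\Delta$ may all depend on $n$; $C$ and $C'$ are absolute constants. ''Almost surely'' means with probability tending to $1$ as $n\to\infty$. *)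

(* Defs.v *)
From HB Require Import structures.
From mathcomp Require Import all_boot all_order all_algebra.
From mathcomp Require Import finmap.
From mathcomp Require Import all_classical all_reals all_analysis.
Import Order.TTheory GRing.Theory Num.Theory.
Import numFieldNormedType.Exports.

Set Implicit Arguments.
Unset Strict Implicit.
Unset Printing Implicit Defensive.

Local Open Scope classical_set_scope.
Local Open Scope ring_scope.

Definition mutually_independent (d : measure_display) (T : measurableType d)
    (R : realType) (P : probability T R) (I : choiceType) (D : set I)
    (X : I -> {RV P >-> R}) : Prop :=
  forall (J : {fset I}) (A : I -> set R),
    [set` J] `<=` D -> (forall i, measurable (A i)) ->
    P (\bigcap_(i in [set` J]) (X i @^-1` A i)) =
    (\prod_(i <- J) P (X i @^-1` A i))%E.

Definition singular_value (R : realType) (m n : nat) (M : 'M[R]_(m, n))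
    (s : R) : Prop :=
  0 <= s /\ eigenvalue (M^T *m M) (s ^+ 2).

(* The set of singular values is finite, so the supremum is a maximum; it is
   [0] for the empty matrix. *)
Definition spectral_norm (R : realType) (m n : nat) (M : 'M[R]_(m, n)) : R :=
  sup [set s | singular_value M s].

(* Only the entries [a i j] with [i <= j] are used. *)
Definition sym_ext (V : Type) (n : nat) (a : 'I_n -> 'I_n -> V)
    (i j : 'I_n) : V :=
  if (i <= j)%N then a i j else a j i.

Definition sym_mx (R : realType) (d : measure_display) (T : measurableType d)
    (P : probability T R) (n : nat) (b : 'I_n -> 'I_n -> {RV P >-> R})
    (w : T) : 'M[R]_n :=
  \matrix_(i, j) sym_ext b i j w.

(* All terms are nonnegative, so starting the maximum at [0] changes its value
   only for [n = 0]. *)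
Definition max_row_variance (R : realType) (n : nat)
    (sigma : 'I_n -> 'I_n -> R) : R :=
  \big[Num.max/0]_(i < n) \sum_(j < n) sym_ext sigma i j ^+ 2.

(* Main.v *)
Require Import Defs.
From HB Require Import structures.
From mathcomp Require Import all_boot all_order all_algebra.
From mathcomp Require Import finmap.
From mathcomp Require Import all_classical all_reals all_analysis.
From mathcomp Require Import measurable_realfun ring lra zify.
Import Order.TTheory GRing.Theory Num.Theory.
Import numFieldNormedType.Exports.

Set Implicit Arguments.
Unset Strict Implicit.
Unset Printing Implicit Defensive.

Local Open Scope ring_scope.

(** The proof is by the moment method: for an even [k], the [k]-th power of the
    spectral norm of the symmetric matrix [B] is at most the trace of [B ^+ k]
    ([singular_value_trace]), and Markov's inequality turns the estimate
    [E tr (B ^+ k) <= 4 n (2 s) ^+ k], where [s] is the square root of Delta, into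
    a tail bound. The estimate holds as long as [K k ^ 2 <= s], so [k] can be as
    large as Delta^(1/4) / sqrt K. With [t = 2 s (1 + e)] and
    [e = 8 ln n sqrt K / Delta^(1/4)], the ratio [(t / 2 s) ^+ k] is at least
    [expR (k e / 2)], which beats the factor [n] ([tail_numerics]); the lower
    bound on Delta makes [e <= 1].

    The trace is a sum over closed walks. By independence and since the entries
    are centered, a walk contributes nothing unless it uses each of its edges at
    least twice. Read a walk step by step: a step either discovers a vertex, or
    goes for the second time over the edge that led to a discovery (an open edge,
    which it closes), or is neutral. The expectation of the product of the entries
    along the walk is then at most the product of the variances of the discovery
    edges, times [K] for each neutral step ([moment_le_walk_weight]).

    It remains to sum these weights. The variances sum to at most Delta along a
    row, so a discovery and its closing cost Delta together and there is nothing
    to choose at a discovery. A neutral step goes to one of at most [k] vertices.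
    A closing step is forced when there is a single open edge at the current
    vertex. The choices at the other closing steps are controlled by a potential,
    the quantity [branching]: it starts from [0], a neutral step adds at most [1]
    to it, a closing step with a choice lowers it, and the number of choices is at
    most its value plus [1]. Hence [l] neutral steps cause at most [l] choices,
    with at most [(l + 1)!] outcomes, and the sum over all walks from a vertex is
    about the sum over [l] of [(2 s) ^+ k (K k ^ 2 / (2 s)) ^+ l (l + 1)], a
    convergent series. This computation is done by recursion on the number of
    steps left, with the explicit majorant [walk_bound] ([sum_walk_weight]).

    Since the almost sure bound on the entries allows exceptional points, the
    moments are those of the entries cut off at [K]. *)

(** * Walks and the branching potential *)

Section Walks.
(* in this part, set notations and lemmas are those of finite sets *)
Import mathcomp.boot.finset.

(** Unordered pairs are encoded by their increasing arrangement, so that a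
    symmetric extension is the composition with [edge]. *)
Definition edge n (i j : 'I_n) : 'I_n * 'I_n := if (i <= j)%N then (i, j) else (j, i).

Lemma edgeC n (i j : 'I_n) : edge i j = edge j i.
Proof.
rewrite /edge; case: (ltngtP i j) => // ij.
by rewrite (val_inj ij).
Qed.

Definition ordered_pair n (e : 'I_n * 'I_n) : bool := (e.1 <= e.2)%N.

Lemma edge_ordered n (i j : 'I_n) : ordered_pair (edge i j).
Proof.
by rewrite /edge /ordered_pair; case: ifP => //= /negbT; rewrite -ltnNge => /ltnW.
Qed.

Lemma ordered_edge n (e : 'I_n * 'I_n) : ordered_pair e -> edge e.1 e.2 = e.
Proof. by rewrite /edge /ordered_pair => ->; case: e. Qed.

Lemma edge_eqP n (i j a b : 'I_n) :
  edge i j = edge a b -> i = a /\ j = b \/ i = b /\ j = a.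
Proof.
by rewrite /edge; case: ifP => _; case: ifP => _ [-> ->]; [left|right|right|left].
Qed.

Lemma edge_eqr n (v u w : 'I_n) : (edge v u == edge v w) = (u == w).
Proof.
apply/eqP/eqP => [/edge_eqP[[]//|[-> ->]//]|->//].
Qed.

Definition open_degree n (F : {set 'I_n * 'I_n}) (v : 'I_n) : nat :=
  #|[set u | edge v u \in F]|.

(** The walker at [v] holds one more half-edge there. In a path with the walker
    at its end every vertex has degree at most 2, so this sum is 0; it measures
    how far the open edges are from being such a path. *)
Definition branching n (F : {set 'I_n * 'I_n}) (v : 'I_n) : nat :=
  (\sum_x (open_degree F x + (x == v) - 2))%N.

Lemma open_degreeU n (F : {set 'I_n * 'I_n}) (v u x : 'I_n) :
  v != u -> edge v u \notin F ->
  open_degree (edge v u |: F) x = (open_degree F x + (x == v) + (x == u))%N.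
Proof.
move=> vu vuF; rewrite /open_degree.
case: (eqVneq x v) => [->|xv].
  rewrite (negbTE vu) addn0 addn1.
  have -> : [set y | edge v y \in edge v u |: F] = u |: [set y | edge v y \in F].
    by apply/setP => y; rewrite !inE edge_eqr.
  by rewrite cardsU1 inE vuF.
case: (eqVneq x u) => [->|xu].
  rewrite addn0 addn1.
  have -> : [set y | edge u y \in edge v u |: F] = v |: [set y | edge u y \in F].
    by apply/setP => y; rewrite !inE (edgeC v u) edge_eqr.
  by rewrite cardsU1 inE edgeC vuF.
rewrite !addn0; congr #|pred_of_set _|; apply/setP => y; rewrite !inE.
case: eqP => // /edge_eqP[[xv' _]|[xu' _]].
  by rewrite xv' eqxx in xv.
by rewrite xu' eqxx in xu.
Qed.

Lemma open_degree_le_branching n (F : {set 'I_n * 'I_n}) (v : 'I_n) :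
  (open_degree F v <= (branching F v).+1)%N.
Proof. by rewrite /branching (bigD1 v) //= eqxx; lia. Qed.

Lemma branching_jump n (F : {set 'I_n * 'I_n}) (v u : 'I_n) :
  (branching F u <= (branching F v).+1)%N.
Proof.
have -> : (branching F v).+1 = (\sum_x ((open_degree F x + (x == v) - 2) + (x == u)))%N.
  rewrite big_split /= -addn1; congr addn.
  by rewrite (bigD1 u) //= eqxx big1 ?addn0 // => x /negbTE ->.
by apply: leq_sum => x _; case: (x == u); case: (x == v); lia.
Qed.

(** The half-edge held at [v] becomes half of the new open edge; the new vertex
    has that edge and the walker. *)
Lemma branching_new n (F : {set 'I_n * 'I_n}) (v u : 'I_n) :
  v != u -> open_degree F u = 0%N -> edge v u \notin F ->
  branching (edge v u |: F) u = branching F v.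
Proof.
move=> vu du vuF; apply: eq_bigr => x _; rewrite open_degreeU //.
case: (eqVneq x u) => [->|_]; last by case: (x == v); lia.
by rewrite du eq_sym (negbTE vu).
Qed.

(** The degree at [v], walker included, drops by 2, from at least 3 when another
    open edge is left at [v]; at [u] the walker replaces the closed edge. *)
Lemma branching_back n (F : {set 'I_n * 'I_n}) (v u : 'I_n) :
  v != u -> edge v u \in F ->
  (branching (F :\ edge v u) u + (1 < open_degree F v) <= branching F v)%N.
Proof.
move=> vu vuF; set F0 := F :\ edge v u.
have F0e : edge v u \notin F0 by rewrite !inE eqxx.
have dF x : open_degree F x = (open_degree F0 x + (x == v) + (x == u))%N.
  by rewrite -open_degreeU // setD1K.
rewrite /branching (bigD1 v) //= [X in (_ <= X)%N](bigD1 v) //= !dF eqxx (negbTE vu).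
have : (\sum_(i < n | i != v) (open_degree F0 i + (i == u) - 2) <=
        \sum_(i < n | i != v) (open_degree F i + (i == v) - 2))%N.
  by apply: leq_sum => x _; rewrite dF; case: (x == u); case: (x == v); lia.
by rewrite !addn0 !addn1; case: ltnP;
  move: (open_degree F0 v) (bigop _ _ _) (bigop _ _ _) => d S S' ? ? /=; lia.
Qed.

Fixpoint walks n j : seq (seq 'I_n) :=
  if j is j'.+1 then [seq u :: p | u <- enum 'I_n, p <- walks n j'] else [:: [::]].

Lemma sum_walksS (V : nmodType) n j (f : seq 'I_n -> V) :
  \sum_(p <- walks n j.+1) f p = \sum_u \sum_(p <- walks n j) f (u :: p).
Proof. by rewrite /= big_allpairs_dep /= big_enum. Qed.

Lemma sum_walks0 (V : nmodType) n (f : seq 'I_n -> V) :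
  \sum_(p <- walks n 0) f p = f [::].
Proof. by rewrite /= big_seq1. Qed.

Section Weights.
Variables (R : realFieldType) (n : nat) (s K : R) (sg : 'I_n * 'I_n -> R).

(** The variance of a discovery edge is spread over the discovery ([sg ^+ 2 / s])
    and the closing ([s]), so that a step of either kind costs at most [s] when a
    closing is forced, and sums over walks scale as [s] to the number of steps. *)
Definition step_weight v (vis : {set 'I_n}) (F : {set 'I_n * 'I_n}) u : R :=
  if u \notin vis then sg (edge v u) ^+ 2 / s
  else if edge v u \in F then s else K.

Definition next_open v (vis : {set 'I_n}) (F : {set 'I_n * 'I_n}) u :=
  if u \notin vis then edge v u |: F else F :\ edge v u.

(** An edge that is still open at the end was used once, and makes the
    expectation vanish. *)
Fixpoint walk_weight v (vis : {set 'I_n}) (F : {set 'I_n * 'I_n}) (p : seq 'I_n) : R :=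
  if p is u :: p' then
    step_weight v vis F u * walk_weight u (u |: vis) (next_open v vis F u) p'
  else (F == set0)%:R.

Definition exploration v (vis : {set 'I_n}) (F : {set 'I_n * 'I_n}) :=
  [/\ v \in vis, {subset F <= @ordered_pair n} &
      forall a b, edge a b \in F -> a != b /\ a \in vis].

Lemma exploration_next v vis F u : exploration v vis F ->
  exploration u (u |: vis) (next_open v vis F u).
Proof.
move=> [vV oF HF]; split; first by rewrite !inE eqxx.
  move=> e; rewrite /next_open; case: ifP => _; rewrite !inE; last by case/andP=> _ /oF.
  by case/orP=> [/eqP->|/oF//]; exact: edge_ordered.
rewrite /next_open => a b; case: ifPn => uV; rewrite !inE.
  have vu : v != u by apply: contraNneq uV => <-.
  case/orP => [/eqP/edge_eqP[[-> ->]|[-> ->]]|/HF[-> ->]].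
  - by rewrite vu vV orbT.
  - by rewrite eq_sym vu eqxx.
  - by rewrite orbT.
by case/andP => _ /HF[-> ->]; rewrite orbT.
Qed.

Variable k : nat.
Hypotheses (s0 : 0 < s) (K0 : 0 <= K) (Kk : K * k%:R ^+ 2 <= s)
  (sgs : forall v, \sum_u sg (edge v u) ^+ 2 <= s ^+ 2).

(** The cost of a neutral step, relative to the cost [2 * s] of the two other
    kinds of steps. *)
Definition neutral_rate : R := k%:R * K / (2 * s).

(** With [l] neutral steps to come among the [j] steps left, the choices number
    at most [(f + l + 1)!]; the sum over [l] of
    [(j * neutral_rate) ^+ l * (f + l + 1)! / l!] is the factor of [(2 * s) ^+ j]. *)
Definition walk_bound j f : R :=
  (2 * s) ^+ j * (f.+1)`!%:R / (1 - j%:R * neutral_rate) ^+ f.+2.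

Lemma neutral_rate_ge0 : 0 <= neutral_rate.
Proof. by rewrite /neutral_rate divr_ge0 // ?mulr_ge0 // ltW. Qed.

Lemma decay_ge_half j : (j <= k)%N -> 1 / 2 <= 1 - j%:R * neutral_rate.
Proof.
move=> jk; have : j%:R * neutral_rate <= k%:R * neutral_rate.
  by rewrite ler_wpM2r ?neutral_rate_ge0 ?ler_nat.
have : k%:R * neutral_rate <= 1 / 2.
  rewrite /neutral_rate mulrA ler_pdivrMr ?mulr_gt0 //.
  by move: Kk; rewrite expr2; nra.
by lra.
Qed.

Lemma decay_le1 j : 1 - j%:R * neutral_rate <= 1.
Proof. by rewrite gerBl mulr_ge0 ?neutral_rate_ge0. Qed.

Lemma walk_bound_gt0 j f : (j <= k)%N -> 0 < walk_bound j f.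
Proof.
move=> jk; have e0 : 0 < 1 - j%:R * neutral_rate by have := decay_ge_half jk; lra.
rewrite /walk_bound divr_gt0 ?exprn_gt0 // mulr_gt0 ?ltr0n ?fact_gt0 //.
by rewrite exprn_gt0 // mulr_gt0.
Qed.

(** A closing step with [f + 2] choices costs no more than one without choice,
    because it lowers the potential. *)
Lemma walk_bound_absorb j f : (j <= k)%N -> f.+2%:R * walk_bound j f <= walk_bound j f.+1.
Proof.
move=> jk; rewrite /walk_bound [in leRHS]factS natrM.
have e0 : 0 < 1 - j%:R * neutral_rate by have := decay_ge_half jk; lra.
rewrite mulrA mulrCA ler_pM2l; last first.
  by rewrite mulr_gt0 ?exprn_gt0 ?mulr_gt0 ?ltr0n ?fact_gt0.
rewrite lef_pV2 ?posrE ?exprn_gt0 //.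
by rewrite exprS ler_piMl ?decay_le1 // ltW // exprn_gt0.
Qed.

Lemma walk_bound_mono j f f' : (j <= k)%N -> (f <= f')%N ->
  walk_bound j f <= walk_bound j f'.
Proof.
move=> jk; elim: f' => [|f' IH]; first by rewrite leqn0 => /eqP ->.
rewrite leq_eqVlt => /orP[/eqP -> //|]; rewrite ltnS => /IH H.
apply: (le_trans H); apply: le_trans (walk_bound_absorb f' jk).
by rewrite ler_peMl ?ler1n // ltW ?walk_bound_gt0.
Qed.

Lemma bernoulli_inequality (x : R) m : 0 <= x -> 1 + m%:R * x <= (1 + x) ^+ m.
Proof.
move=> x0; elim: m => [|m IH]; first by rewrite mul0r addr0 expr0.
rewrite exprS -natr1.
apply: le_trans (_ : (1 + x) * (1 + m%:R * x) <= _); last first.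
  by rewrite ler_wpM2l // addr_ge0.
have : 0 <= m%:R * x * x by rewrite !mulr_ge0.
by nra.
Qed.

(** The recursion for the majorant: with [u = neutral_rate / y], it says that
    [(1 + m * u) * (1 - u) ^+ m <= 1], which is Bernoulli's inequality. *)
Lemma walk_bound_step j f : (j < k)%N ->
  2 * s * walk_bound j f + k%:R * K * walk_bound j f.+1 <= walk_bound j.+1 f.
Proof.
move=> jk; rewrite /walk_bound.
set y := 1 - j%:R * neutral_rate; set z := 1 - j.+1%:R * neutral_rate.
have z0 : 0 < z by have := decay_ge_half jk; rewrite /z; lra.
have e0 := neutral_rate_ge0.
have yz : y = z + neutral_rate by rewrite /y /z -natr1; ring.
have y0 : 0 < y by rewrite yz; lra.
have -> : k%:R * K = 2 * s * neutral_rate.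
  by rewrite /neutral_rate mulrCA mulfV ?mulr1 // mulf_neq0 // ?gt_eqF.
rewrite [f.+2`!]factS natrM.
have -> : 2 * s * ((2 * s) ^+ j * f.+1`!%:R / y ^+ f.+2) +
   2 * s * neutral_rate * ((2 * s) ^+ j * (f.+2%:R * f.+1`!%:R) / y ^+ f.+3) =
   (2 * s) ^+ j.+1 * f.+1`!%:R * ((1 + f.+2%:R * (neutral_rate / y)) / y ^+ f.+2).
  rewrite [y ^+ f.+3]exprS [(2 * s) ^+ j.+1]exprS; field.
  by rewrite expf_neq0 ?gt_eqF.
have c0 : 0 < (2 * s) ^+ j.+1 * f.+1`!%:R.
  by rewrite mulr_gt0 ?exprn_gt0 ?mulr_gt0 ?ltr0n ?fact_gt0.
rewrite ler_pM2l //.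
rewrite ler_pdivrMr ?exprn_gt0 // [leRHS]mulrC -expr_div_n.
apply: (le_trans (bernoulli_inequality _ _)); first by rewrite divr_ge0 // ltW.
have a0 : 0 <= neutral_rate / y by rewrite divr_ge0 // ltW.
have b0 : 0 <= y / z by rewrite divr_ge0 // ltW.
rewrite lerXn2r ?nnegrE ?addr_ge0 //.
rewrite ler_pdivlMr // mulrDl mul1r mulrAC -lerBrDl ler_pdivrMr //.
by move: e0 z0 y0; rewrite yz; nra.
Qed.

Lemma step_weight_ge0 v vis F u : 0 <= step_weight v vis F u.
Proof.
rewrite /step_weight; case: ifP => _; first by rewrite divr_ge0 ?sqr_ge0 ?(ltW s0).
by case: ifP => // _; exact: ltW.
Qed.

Lemma walk_weight_ge0 v vis F p : 0 <= walk_weight v vis F p.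
Proof.
elim: p v vis F => [|u p IH] v vis F /=; first by rewrite ler0n.
by rewrite mulr_ge0 ?step_weight_ge0.
Qed.

(** The first step discovers a vertex, closes an open edge or is neutral. The
    three kinds contribute at most [s * walk_bound j f], the same again, and
    [k * K * walk_bound j f.+1]. The bound on [#|vis|] counts the targets of
    neutral steps. *)
Lemma sum_walk_weight j v vis F : exploration v vis F -> (#|vis| + j <= k.+1)%N ->
  \sum_(p <- walks n j) walk_weight v vis F p <= walk_bound j (branching F v).
Proof.
elim: j v vis F => [|j IH] v vis F [vV oF HF] Hk.
  rewrite sum_walks0 /= /walk_bound expr0 mul0r subr0 expr1n divr1 mul1r.
  apply: (@le_trans _ _ 1); first by case: eqP.
  by rewrite ler1n fact_gt0.
have v1 : (0 < #|vis|)%N by apply/card_gt0P; exists v.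
have jk : (j < k)%N by lia.
rewrite sum_walksS; under eq_bigr do rewrite /= -mulr_sumr.
set f := branching F v.
pose rest u := \sum_(p <- walks n j) walk_weight u (u |: vis) (next_open v vis F u) p.
rewrite -/(\sum_u step_weight v vis F u * rest u).
have IHu u : rest u <= walk_bound j (branching (next_open v vis F u) u).
  apply: IH; first exact: exploration_next.
  by apply: leq_trans Hk; rewrite addnS -addSn leq_add2r cardsU1; case: (u \in vis).
rewrite (bigID (fun u => u \notin vis)) /=.
rewrite [X in _ + X](bigID (fun u => edge v u \in F)) /=.
have jk' := ltnW jk.
have Gf0 := walk_bound_gt0 f jk'.
have H1 : \sum_(u | u \notin vis) step_weight v vis F u * rest u
    <= s * walk_bound j f.
  apply: le_trans (_ : \sum_u sg (edge v u) ^+ 2 / s * walk_bound j f <= _); last first.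
    rewrite -mulr_suml ler_pM2r // -mulr_suml ler_pdivrMr // -expr2; exact: sgs.
  rewrite big_mkcond /=; apply: ler_sum => u _; case: ifPn => uV; last first.
    exact: mulr_ge0 (divr_ge0 (sqr_ge0 _) (ltW s0)) (ltW Gf0).
  rewrite /step_weight uV ler_wpM2l ?divr_ge0 ?sqr_ge0 ?(ltW s0) //.
  apply: (le_trans (IHu u)); rewrite /next_open uV.
  have vu : v != u by apply: contraNneq uV => <-.
  rewrite branching_new //.
    rewrite /open_degree (_ : [set x | _] = set0) ?cards0 //; apply/setP => x.
    by rewrite !inE; apply: contraNF uV => /HF[].
  by apply: contraNN uV; rewrite edgeC => /HF[].
have H2 : \sum_(u | ~~ (u \notin vis) && (edge v u \in F)) step_weight v vis F u * rest u
    <= s * walk_bound j f.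
  (* [g] bounds the rest of the walk after a closing step, by [branching_back] *)
  pose g := if (1 < open_degree F v)%N then walk_bound j f.-1 else walk_bound j f.
  have dle : (open_degree F v)%:R * g <= walk_bound j f.
    rewrite /g; case: ifPn => [d1|]; last first.
      by rewrite -leqNgt => d1; rewrite ler_piMl ?lern1 // ltW.
    have dp := open_degree_le_branching F v.
    have f0 : f = f.-1.+1 by rewrite prednK // /f; lia.
    rewrite [in leRHS]f0; apply: le_trans (walk_bound_absorb _ jk').
    apply: ler_wpM2r; first by rewrite ltW ?walk_bound_gt0.
    by rewrite ler_nat -f0.
  apply: le_trans (_ : s * ((open_degree F v)%:R * g) <= _); last by rewrite ler_pM2l.
  have g0 : 0 <= g by rewrite /g; case: ifP => _; rewrite ltW ?walk_bound_gt0.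
  rewrite /open_degree -sum1_card natr_sum mulr_suml mulr_sumr.
  rewrite big_mkcond [leRHS]big_mkcond /=.
  apply: ler_sum => u _; rewrite inE negbK mul1r.
  case: ifPn => [/andP[uV uF]|_]; last first.
    by case: ifP => // _; rewrite mulr_ge0 // ltW.
  rewrite uF /step_weight uV uF /= ler_pM2l //.
  apply: (le_trans (IHu u)); rewrite /next_open uV /=.
  have [vu _] := HF _ _ uF.
  have := branching_back vu uF; rewrite -/f /g.
  case: ifP => _; rewrite ?addn0 ?addn1 => Hp; apply: walk_bound_mono => //.
  by rewrite -ltnS (leq_trans Hp) // leqSpred.
have H3 : \sum_(u | ~~ (u \notin vis) && (edge v u \notin F)) step_weight v vis F u * rest u
    <= k%:R * K * walk_bound j f.+1.
  apply: le_trans (_ : \sum_(u in vis) K * walk_bound j f.+1 <= _); last first.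
    rewrite sumr_const -[leLHS]mulr_natl -[leRHS]mulrA; apply: ler_wpM2r.
      by rewrite mulr_ge0 // ltW ?walk_bound_gt0.
    by rewrite ler_nat -ltnS (leq_trans _ Hk) // addnS ltnS leq_addr.
  rewrite big_mkcond [leRHS]big_mkcond /=; apply: ler_sum => u _; rewrite negbK.
  case: ifPn => [/andP[uV uF]|_]; last first.
    by case: ifP => // _; rewrite mulr_ge0 // ltW ?walk_bound_gt0.
  rewrite uV /step_weight uV (negbTE uF) /= ler_wpM2l //.
  apply: (le_trans (IHu u)); apply: walk_bound_mono => //; rewrite /next_open uV /=.
  have -> : F :\ edge v u = F.
    by apply/setP => x; rewrite !inE; case: eqP => // ->; rewrite (negbTE uF).
  exact: branching_jump.
apply: le_trans (walk_bound_step f jk); lra.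
Qed.

Lemma sum_walk_weight_start v :
  \sum_(p <- walks n k) walk_weight v [set v] set0 p <= 4 * (2 * s) ^+ k.
Proof.
have ex : exploration v [set v] set0.
  by split=> [|e|a b]; rewrite ?inE.
apply: (le_trans (sum_walk_weight ex _)); first by rewrite cards1.
have -> : branching set0 v = 0%N.
  apply: big1 => x _; rewrite /open_degree (_ : [set u | _] = set0) ?cards0.
    by case: (_ == _).
  by apply/setP => y; rewrite !inE.
have := decay_ge_half (leqnn k); rewrite /walk_bound mulr1 => e2.
rewrite ler_pdivrMr; last by rewrite exprn_gt0 //; lra.
rewrite mulrAC; apply: ler_peMl; first by rewrite exprn_ge0 // mulr_ge0 // ltW.
rewrite expr2; nra.
Qed.

End Weights.

(** * Moments along a walk *)

Fixpoint edge_count n (v : 'I_n) (p : seq 'I_n) (e : 'I_n * 'I_n) : nat :=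
  if p is u :: p' then ((edge v u == e) + edge_count u p' e)%N else 0%N.

Fixpoint path_prod (R : pzRingType) n (x : 'I_n * 'I_n -> R) (v : 'I_n)
    (p : seq 'I_n) : R :=
  if p is u :: p' then x (edge v u) * path_prod x u p' else 1.

Lemma prod_at_edge (R : comPzRingType) n (v u : 'I_n) (x : 'I_n * 'I_n -> R) :
  \prod_(e | ordered_pair e) (if edge v u == e then x e else 1) = x (edge v u).
Proof.
rewrite (bigD1 (edge v u)) ?edge_ordered //= eqxx big1 ?mulr1 // => e /andP[_].
by rewrite eq_sym => /negbTE ->.
Qed.

Lemma path_prodE (R : comPzRingType) n (x : 'I_n * 'I_n -> R) v p :
  path_prod x v p = \prod_(e | ordered_pair e) x e ^+ edge_count v p e.
Proof.
elim: p v => [|u p IH] v /=; first by rewrite big1.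
rewrite IH -(prod_at_edge v u x) -big_split /=; apply: eq_bigr => e _.
by case: eqP; rewrite ?add1n ?exprS // mul1r.
Qed.

Lemma mxpow_walks (R : comPzRingType) n (x : 'I_n * 'I_n -> R) k (v w : 'I_n) :
  ((\matrix_(i, j) x (edge i j)) ^+ k) v w =
  \sum_(p <- walks n k | last v p == w) path_prod x v p.
Proof.
elim: k v => [|k IH] v.
  by rewrite expr0 big_mkcond sum_walks0 /= !mxE; case: (v == w).
rewrite exprS mxE [RHS]big_mkcond sum_walksS; apply: eq_bigr => u _.
by rewrite mxE IH mulr_sumr [LHS]big_mkcond; apply: eq_bigr => p _.
Qed.

Section MomentDomination.
Variables (R : realFieldType) (n : nat) (s K : R) (sg : 'I_n * 'I_n -> R).
Variable q : 'I_n * 'I_n -> nat -> R.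
Hypotheses (s0 : 0 < s) (K0 : 0 <= K) (q_ge0 : forall e m, 0 <= q e m)
  (q_le : forall e m, ordered_pair e -> q e m <= K ^+ m)
  (q1 : forall e, ordered_pair e -> q e 1%N = 0)
  (q2 : forall e m, ordered_pair e -> q e m.+2 <= sg e ^+ 2 * K ^+ m).

(** For an edge used [m e] times so far, [c e] is the product of the weights of
    the steps that used it. An open edge has been used only for its discovery;
    for the others, [c e] bounds the moment of order [m e], either trivially or
    through the variance. *)
Definition edge_account (vis : {set 'I_n}) (F : {set 'I_n * 'I_n})
    (m : 'I_n * 'I_n -> nat) (c : 'I_n * 'I_n -> R) :=
  forall a b, let e := edge a b in
  (if e \in F then m e = 1%N /\ c e = sg e ^+ 2 / s
   else c e = K ^+ m e \/ exists2 m', m e = m'.+2 & c e = sg e ^+ 2 * K ^+ m')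
  /\ ((0 < m e)%N -> a \in vis).

Lemma edge_account_next v vis F u m c : exploration v vis F -> edge_account vis F m c ->
  edge_account (u |: vis) (next_open v vis F u)
    (fun e => (m e + (edge v u == e))%N)
    (fun e => c e * (if edge v u == e then step_weight s K sg v vis F u else 1)).
Proof.
move=> [vV _ HF] Hm a b /=.
have Fnext : edge v u != edge a b ->
    (edge a b \in next_open v vis F u) = (edge a b \in F).
  rewrite /next_open => ne.
  by case: ifP => _; rewrite !inE [_ == edge v u]eq_sym (negbTE ne).
case: (eqVneq (edge v u) (edge a b)) => [e_ab|ne]; last first.
  rewrite Fnext // addn0 mulr1; have [? mV] := Hm a b; split => // /mV.
  by rewrite !inE => ->; rewrite orbT.
rewrite -e_ab addn1; split; last first.
  by move=> _; have [[<- _]|[_ <-]] := edge_eqP e_ab; rewrite !inE ?eqxx // vV orbT.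
have [Hc mV] := Hm v u; have [_ mVu] := Hm u v.
rewrite /next_open /step_weight; case: (boolP (u \notin vis)) => uV.
  have m0 : m (edge v u) = 0%N.
    by apply/eqP; rewrite -leqn0 leqNgt edgeC; exact: contraNN mVu uV.
  move: Hc; case: ifPn => [/HF|_]; first by rewrite m0 => -[_ _] [].
  by rewrite m0 !inE eqxx; case=> [->|[]//]; rewrite mul1r.
move: Hc; case: (boolP (edge v u \in F)) => eF; rewrite !inE eqxx /=.
  by case=> -> ->; right; exists 0%N => //; rewrite mulr1 divfK // gt_eqF.
case=> [->|[m' -> ->]]; first by left; rewrite exprSr.
by right; exists m'.+1; rewrite // [K ^+ m'.+1]exprSr mulrA.
Qed.

(** The moments are not multiplicative along the walk, whereas the accounts are:
    the induction moves the weights of the steps one by one into the accounts,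
    which are compared with the moments at the end. *)
Lemma moment_le_account p v vis F m c : exploration v vis F -> edge_account vis F m c ->
  \prod_(e | ordered_pair e) q e (m e + edge_count v p e) <=
  (\prod_(e | ordered_pair e) c e) * walk_weight s K sg v vis F p.
Proof.
elim: p v vis F m c => [|u p IH] v vis F m c Hex Hm /=; last first.
  have := IH _ _ _ _ _ (exploration_next u Hex) (edge_account_next u Hex Hm).
  rewrite big_split /= prod_at_edge -mulrA; congr (_ <= _); apply: eq_bigr => e _.
  by rewrite addnA.
case: eqP => [F0|/eqP/set0Pn[e eF]] /=.
  rewrite mulr1; apply: ler_prod => e oe; rewrite q_ge0 addn0 /=.
  have [+ _] := Hm e.1 e.2; rewrite ordered_edge // F0 inE.
  by case=> [->|[m' -> ->]]; rewrite ?q_le ?q2.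
rewrite mulr0 le_eqVlt; apply/orP; left.
have [_ /(_ _ eF) oe _] := Hex; rewrite unfold_in in oe.
rewrite (bigD1 e) //= addn0; have [+ _] := Hm e.1 e.2.
by rewrite ordered_edge // eF => -[-> _]; rewrite q1 // mul0r.
Qed.

Lemma moment_le_walk_weight p v :
  \prod_(e | ordered_pair e) q e (edge_count v p e) <=
  walk_weight s K sg v [set v] set0 p.
Proof.
have ex : exploration v [set v] set0.
  by split=> [|e|a b]; rewrite ?inE.
have ac : edge_account [set v] set0 (fun=> 0%N) (fun=> 1).
  by move=> a b /=; rewrite inE; split=> //; left.
have := moment_le_account p ex ac.
by rewrite big1_eq mul1r; under eq_bigr do rewrite add0n.
Qed.

End MomentDomination.

End Walks.

Local Open Scope classical_set_scope.

(** * Spectral norm of a symmetric matrix *)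

(** Expand the sum of the squares of [X * y i - Z * x i]. *)
Lemma sum_Cauchy_Schwarz (R : realFieldType) (I : finType) (x y : I -> R) :
  (\sum_i x i * y i) ^+ 2 <= (\sum_i x i ^+ 2) * \sum_i y i ^+ 2.
Proof.
set X := \sum_i x i ^+ 2; set Y := \sum_i y i ^+ 2; set Z := \sum_i x i * y i.
have X0 : 0 <= X by apply: sumr_ge0 => i _; exact: sqr_ge0.
have H : 0 <= \sum_i (X * y i - Z * x i) ^+ 2.
  by apply: sumr_ge0 => i _; exact: sqr_ge0.
have E : \sum_i (X * y i - Z * x i) ^+ 2 = X * (X * Y - Z ^+ 2).
  transitivity (\sum_i (X ^+ 2 * y i ^+ 2 + (- (2 * X * Z)) * (x i * y i)
      + Z ^+ 2 * x i ^+ 2)).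
    by apply: eq_bigr => i _; ring.
  by rewrite !big_split /= -!mulr_sumr -/X -/Y -/Z; ring.
case: (ltrgt0P X) X0 => // X0 _.
  by move: H; rewrite E pmulr_rge0 // subr_ge0.
suff -> : Z = 0 by rewrite expr0n /= X0 mul0r.
apply: big1 => i _; suff -> : x i = 0 by rewrite mul0r.
have /eqP := X0; rewrite psumr_eq0 => [/allP/(_ i)|? _]; last exact: sqr_ge0.
by rewrite mem_index_enum sqrf_eq0 => /(_ isT) /eqP.
Qed.

Lemma mulmx_trE (R : realFieldType) n (v : 'rV[R]_n) :
  (v *m v^T) 0 0 = \sum_i v 0 i ^+ 2.
Proof. by rewrite mxE; apply: eq_bigr => i _; rewrite mxE expr2. Qed.

Lemma trmxX (R : comPzRingType) n (M : 'M[R]_n) k : (M ^+ k)^T = M^T ^+ k.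
Proof.
elim: k => [|k IH]; first by rewrite !expr0 trmx1.
by rewrite exprS exprSr -[M * _]/(M *m _) trmx_mul IH.
Qed.

(** If [v] is an eigenvector and [Q = M ^+ k], then [s ^+ k.*2 |v|^2 = |v Q|^2],
    at most [|v|^2] times the sum of the squares of the entries of [Q], which is
    the trace of [Q *m Q^T = M ^+ k.*2]. *)
Lemma singular_value_trace (R : realType) n (M : 'M[R]_n) s k : M^T = M ->
  singular_value M s -> s ^+ k.*2 <= \tr (M ^+ k.*2).
Proof.
move=> MT [s0 /eigenvalueP[v vM v0]].
have vMM : v *m (M ^+ k.*2) = s ^+ k.*2 *: v.
  elim: k => [|k IH]; first by rewrite !expr0 mulmx1 scale1r.
  rewrite doubleS 2!exprS mulrA -[M * M * _]/(M *m M *m _) mulmxA -{1}MT vM.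
  by rewrite -scalemxAl IH scalerA -exprD.
set Q := M ^+ k.
have QT : Q^T = Q by rewrite trmxX MT.
have QQ : M ^+ k.*2 = Q *m Q^T by rewrite QT -addnn exprD.
have trQ : \tr (M ^+ k.*2) = \sum_i \sum_j Q i j ^+ 2.
  rewrite QQ /mxtrace; apply: eq_bigr => i _; rewrite mxE.
  by apply: eq_bigr => j _; rewrite mxE expr2.
have v2 : 0 < \sum_i v 0 i ^+ 2.
  rewrite lt_neqAle sumr_ge0 ?andbT; last by move=> i _; exact: sqr_ge0.
  apply: contra v0 => /eqP/esym/eqP.
  rewrite psumr_eq0 => [/allP H|i _]; last exact: sqr_ge0.
  apply/eqP/rowP => i; rewrite mxE; apply/eqP.
  by have := H i; rewrite mem_index_enum sqrf_eq0 => /(_ isT).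
rewrite -(ler_pM2r v2) -mulmx_trE.
have -> : s ^+ k.*2 * (v *m v^T) 0 0 = ((v *m Q) *m (v *m Q)^T) 0 0.
  by rewrite trmx_mul mulmxA -(mulmxA v) -QQ vMM -scalemxAl [RHS]mxE.
rewrite !mulmx_trE trQ exchange_big /= mulr_suml; apply: ler_sum => j _.
by rewrite mxE mulrC; exact: sum_Cauchy_Schwarz.
Qed.

Lemma lt_spectral_norm (R : realType) n (M : 'M[R]_n) t : 0 <= t ->
  t < spectral_norm M -> exists2 s, singular_value M s & t < s.
Proof.
move=> t0 tM; apply: contrapT => H; move: tM; rewrite ltNge => /negP; apply.
rewrite /spectral_norm; have [->|/set0P ne] := eqVneq [set s | singular_value M s] set0.
  by rewrite sup0.
apply: ge_sup => // s sM; rewrite leNgt; apply/negP => ts; apply: H.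
by exists s.
Qed.

(** This form makes the event measurable: it only involves the zeros of a
    characteristic polynomial. *)
Lemma spectral_norm_le (R : realType) n (M : 'M[R]_n) t : M^T = M -> 0 <= t ->
  spectral_norm M <= t <->
  forall x, t ^+ 2 < x -> ~ eigenvalue (M^T *m M) x.
Proof.
move=> MT t0; split=> [Mt x tx ex|H].
  have x0 : 0 <= x by apply: le_trans (ltW tx); exact: sqr_ge0.
  have sx : singular_value M (Num.sqrt x).
    by split; rewrite ?sqrtr_ge0 // sqr_sqrtr.
  have : Num.sqrt x <= spectral_norm M.
    apply: ub_le_sup => //.
    exists (1 + \tr (M ^+ 2)) => s /(singular_value_trace 1 MT) /= H.
    have := sqr_ge0 (s - 1); move: H; rewrite /= sqrrB1; nra.
  move=> /le_trans /(_ Mt); rewrite leNgt => /negP; apply.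
  by rewrite -[ltLHS](ger0_norm t0) -sqrtr_sqr ltr_sqrt // (le_lt_trans _ tx) // sqr_ge0.
rewrite leNgt; apply/negP => /(lt_spectral_norm t0)[s [s0 es] ts].
apply: (H (s ^+ 2)) => //.
by rewrite ltrXn2r ?nnegrE.
Qed.

Lemma horner_char_poly (R : comNzRingType) n (A : 'M[R]_n) x :
  (char_poly A).[x] = \det (x%:M - A).
Proof.
rewrite /char_poly -horner_evalE -det_map_mx; congr (\det _).
apply/matrixP => i j.
by rewrite !mxE /= horner_evalE hornerD hornerN hornerC hornerMn hornerX.
Qed.

Section MeasurableRoot.
Context d (T : measurableType d) (R : realType).

(** By compactness, a polynomial has a root in a segment if and only if it takes
    arbitrarily small values at rational points of the segment; and a half-line is
    a countable union of segments. *)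
Lemma measurable_root_gt (p : T -> {poly R}) (c : R) :
  (forall x, measurable_fun setT (fun w => (p w).[x])) ->
  measurable [set w | exists2 x, c < x & root (p w) x].
Proof.
move=> mp.
pose near_root m q (r : rat) : set T :=
  if (c + m.+1%:R^-1 <= (ratr r : R)) && ((ratr r : R) <= m%:R :> R)
  then [set w | `|(p w).[ratr r : R]| < (q.+1%:R^-1 : R)] else set0.
rewrite (_ : [set w | _] =
  \bigcup_m \bigcap_q \bigcup_r near_root m q r); last first.
  apply/seteqP; split=> w /=.
    move=> [x cx px].
    have [m1 Hm1] : exists m1, c + m1.+1%:R^-1 < x := ltr_add_invr cx.
    pose m := maxn m1 (Num.truncn x).+1.
    have mx1 : c + m.+1%:R^-1 < x.
      apply: le_lt_trans Hm1; rewrite lerD2l lef_pV2 ?posrE ?ltr0n // ler_nat ltnS.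
      exact: leq_maxl.
    have mx2 : x < m%:R.
      by apply: lt_le_trans (truncnS_gt x) _; rewrite ler_nat leq_maxr.
    exists m => // q _.
    have : \forall y \near x,
        `|(p w).[y]| < q.+1%:R^-1 /\ (y < m%:R) /\ (c + m.+1%:R^-1 < y).
      near=> y; split; last by split; near: y; [exact: lt_nbhsl|exact: lt_nbhsr].
      near: y.
      have /cvgr_norm_lt : (p w).[y] @[y --> x] --> (p w).[x] by exact: continuous_horner.
      by apply; rewrite (rootP px) normr0 invr_gt0 ltr0n.
    move=> /nbhs_ballP[e /= e0 He].
    have [r] := @rat_in_itvoo R x (x + e) (ltr_pwDr e0 (lexx x)).
    rewrite in_itv /= => /andP[xr rxe].
    have [|H1 [H2 H3]] := He (ratr r).
      by rewrite /ball /= ltr_distlC; apply/andP; split => //; lra.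
    by exists r => //; rewrite /near_root (ltW H2) (ltW H3).
  move=> [m _ Hm].
  have [r0 _] := Hm 0%N I; rewrite /near_root; case: ifP => // /andP[r1 r2] _.
  have ab := le_trans r1 r2.
  have [|x0 x0ab x0min] := @EVT_min R (fun x => `|(p w).[x]|) _ _ ab.
    apply: continuous_subspaceT => x; apply: (@cvg_norm _ R^o).
    exact: continuous_horner.
  exists x0.
    apply: lt_le_trans (_ : c + m.+1%:R^-1 <= _); first by rewrite ltrDl invr_gt0 ltr0n.
    by move: x0ab; rewrite in_itv => /andP[].
  rewrite /root -normr_le0 leNgt; apply/negP => px0.
  have [q Hq] := ltr_add_invr px0; rewrite add0r in Hq.
  have [r _] := Hm q I; rewrite /near_root; case: ifP => // rab /= pr.
  have := x0min (ratr r); rewrite in_itv /= rab => /(_ isT) x0r.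
  by have := lt_trans (le_lt_trans x0r pr) Hq; rewrite ltxx.
apply: bigcup_measurable => m _; apply: bigcapT_measurable => q.
apply: bigcupT_measurable_rat => r; rewrite /near_root; case: ifP => // _.
rewrite -[X in measurable X]setTI.
have mpr : measurable_fun setT (fun w => `|(p w).[ratr r]|) by exact: measurableT_comp.
rewrite [X in _ `&` X](_ : _ = (fun w => `|(p w).[ratr r]|) @^-1` `]-oo, q.+1%:R^-1[).
  by apply: mpr => //; exact: measurable_itv.
by apply/seteqP; split=> w /=; rewrite in_itv.
Unshelve. all: by end_near. Qed.

Lemma measurable_det n (A : T -> 'M[R]_n) :
  (forall i j, measurable_fun setT (fun w => A w i j)) ->
  measurable_fun setT (fun w => \det (A w)).
Proof.
move=> mA; rewrite /determinant; apply: measurable_sum => s.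
by apply: measurable_funM => //; apply: measurable_prod.
Qed.

Lemma measurable_spectral_norm_le n (A : T -> 'M[R]_n) t : 0 <= t ->
  (forall w, (A w)^T = A w) ->
  (forall i j, measurable_fun setT (fun w => A w i j)) ->
  measurable [set w | spectral_norm (A w) <= t].
Proof.
move=> t0 AT mA.
rewrite (_ : [set w | _] = ~` [set w | exists2 x, t ^+ 2 < x &
   root (char_poly ((A w)^T *m A w)) x]); last first.
  apply/seteqP; split=> w /=.
    move=> /(spectral_norm_le (AT w) t0) H [x tx].
    by rewrite -eigenvalue_root_char; exact: H.
  move=> H; apply/(spectral_norm_le (AT w) t0) => x tx ex; apply: H.
  by exists x => //; rewrite -eigenvalue_root_char.
apply: measurableC; apply: measurable_root_gt => x.
under eq_fun do rewrite horner_char_poly.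
apply: measurable_det => i j.
under eq_fun do rewrite !mxE.
apply: measurable_funB => //; apply: measurable_sum => k.
by under eq_fun do rewrite mxE; apply: measurable_funM.
Qed.
End MeasurableRoot.

(** * Expectation of a product of independent variables *)

Definition bounded_mfun d (T : measurableType d) (R : realType) (f : T -> R) :=
  measurable_fun setT f /\ exists M : R, forall w, `|f w| <= M.

Section BoundedFunctions.
Context d (T : measurableType d) (R : realType).
Implicit Types f g : T -> R.

Lemma bounded_mfun_cst (c : R) : bounded_mfun (fun _ : T => c).
Proof. by split => //; exists `|c|. Qed.

Lemma bounded_mfunD f g : bounded_mfun f -> bounded_mfun g ->
  bounded_mfun (fun w => f w + g w).
Proof.
move=> [mf [M Mf]] [mg [N Ng]]; split; first exact: measurable_funD.
by exists (M + N) => w; rewrite (le_trans (ler_normD _ _)) // lerD.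
Qed.

Lemma bounded_mfunM f g : bounded_mfun f -> bounded_mfun g ->
  bounded_mfun (fun w => f w * g w).
Proof.
move=> [mf [M Mf]] [mg [N Ng]]; split; first exact: measurable_funM.
by exists (M * N) => w; rewrite normrM ler_pM.
Qed.

Lemma bounded_mfun_indic (A : set T) : measurable A ->
  bounded_mfun (\1_A : T -> R).
Proof.
move=> mA; split; first exact: measurable_indic.
by exists 1 => w; rewrite indicE; case: (_ \in _); rewrite ?normr1 ?normr0.
Qed.

Lemma bounded_mfun_sum (I : Type) (s : seq I) (P : pred I) (f : I -> T -> R) :
  (forall i, P i -> bounded_mfun (f i)) ->
  bounded_mfun (fun w => \sum_(i <- s | P i) f i w).
Proof.
move=> bf; elim: s => [|i s IH].
  by under eq_fun do rewrite big_nil; exact: bounded_mfun_cst.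
under eq_fun do rewrite big_cons.
by have [Pi|_] := boolP (P i); [exact: bounded_mfunD (bf _ Pi) IH|].
Qed.

Lemma bounded_mfun_prod (I : Type) (s : seq I) (P : pred I) (f : I -> T -> R) :
  (forall i, P i -> bounded_mfun (f i)) ->
  bounded_mfun (fun w => \prod_(i <- s | P i) f i w).
Proof.
move=> bf; elim: s => [|i s IH].
  by under eq_fun do rewrite big_nil; exact: bounded_mfun_cst.
under eq_fun do rewrite big_cons.
by have [Pi|_] := boolP (P i); [exact: bounded_mfunM (bf _ Pi) IH|].
Qed.

Lemma bounded_mfunX f k : bounded_mfun f -> bounded_mfun (fun w => f w ^+ k).
Proof.
move=> [mf [M Mf]]; split; first exact: measurable_funX.
by exists (M ^+ k) => w; rewrite normrX lerXn2r ?nnegrE // (le_trans _ (Mf w)).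
Qed.

Lemma bounded_mfun_comp d' (T' : measurableType d') (X : T' -> T) f :
  measurable_fun setT X -> bounded_mfun f -> bounded_mfun (fun w => f (X w)).
Proof.
move=> mX [mf [M Mf]]; split; first exact: measurableT_comp.
by exists M.
Qed.

Variable P : probability T R.

Lemma bounded_mfun_integrable f : bounded_mfun f -> P.-integrable setT (EFin \o f).
Proof.
move=> [mf [M Mf]]; apply: measurable_bounded_integrable => //.
  by rewrite (le_lt_trans (probability_le1 _ _)) ?ltry.
exists M; split; first exact: num_real.
by move=> x Mx w _ /=; apply: le_trans (Mf w) (ltW Mx).
Qed.

Definition mean f : R := \int[P]_w f w.

Lemma mean_cst c : mean (fun=> c) = c.
Proof. by rewrite /mean Rintegral_cst //= probability_setT mulr1. Qed.

Lemma meanD f g : bounded_mfun f -> bounded_mfun g ->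
  mean (fun w => f w + g w) = mean f + mean g.
Proof. by move=> bf bg; rewrite /mean RintegralD //; exact: bounded_mfun_integrable. Qed.

Lemma meanZ c f : bounded_mfun f -> mean (fun w => c * f w) = c * mean f.
Proof. by move=> bf; rewrite /mean RintegralZl //; exact: bounded_mfun_integrable. Qed.

Lemma mean_sum (I : Type) (s : seq I) (Q : pred I) (f : I -> T -> R) :
  (forall i, Q i -> bounded_mfun (f i)) ->
  mean (fun w => \sum_(i <- s | Q i) f i w) = \sum_(i <- s | Q i) mean (f i).
Proof.
move=> bf; elim: s => [|i s IH].
  by under [X in mean X]eq_fun do rewrite big_nil; rewrite big_nil mean_cst.
under [X in mean X]eq_fun do rewrite big_cons.
rewrite big_cons; have [Qi|_ //] := boolP (Q i).
by rewrite meanD ?IH //; [exact: bf|exact: bounded_mfun_sum].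
Qed.

Lemma mean_le f g : bounded_mfun f -> bounded_mfun g -> (forall w, f w <= g w) ->
  mean f <= mean g.
Proof.
by move=> bf bg fg; apply: le_Rintegral => //; exact: bounded_mfun_integrable.
Qed.

Lemma mean_norm_le f M : bounded_mfun f -> (forall w, `|f w| <= M) -> `|mean f| <= M.
Proof.
move=> bf Mf; rewrite ler_norml -[- M]mean_cst -[in X in _ && X](mean_cst M).
have Mf' w : - M <= f w <= M by rewrite -ler_norml.
by apply/andP; split; apply: mean_le => //; try exact: bounded_mfun_cst;
  move=> w; have /andP[] := Mf' w.
Qed.

Lemma mean_indic (A : set T) : measurable A -> mean (\1_A) = fine (P A).
Proof. by move=> mA; rewrite /mean /Rintegral integral_indic // setIT. Qed.

Lemma EFin_mean f : bounded_mfun f -> (mean f)%:E = (\int[P]_w (f w)%:E)%E.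
Proof.
move=> bf; rewrite /mean /Rintegral fineK //.
exact: integrable_fin_num (bounded_mfun_integrable bf).
Qed.

End BoundedFunctions.

(** Layer-cake form of the integer part: a bounded function is uniformly
    approximated by a combination of indicators of its superlevel sets. *)
Lemma staircase (R : realFieldType) (y : R) N : 0 <= y <= N%:R ->
  0 <= y - \sum_(a < N) (a.+1%:R <= y)%R%:R <= 1.
Proof.
elim: N => [|N IH] /andP[y0 yN].
  by rewrite big_ord0 subr0 y0 (le_trans yN).
rewrite big_ord_recr /=; have [yN'|yN'] := leP y N%:R.
  rewrite (_ : (N.+1%:R <= y) = false) ?addr0; first by apply: IH; rewrite y0.
  by apply/negbTE; rewrite -ltNge (le_lt_trans yN') // ltr_nat.
rewrite (_ : \sum_(a < N) _ = N%:R); last first.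
  rewrite (eq_bigr (fun=> 1)) ?sumr_const ?card_ord // => a _.
  by rewrite (le_trans _ (ltW yN')) // ler_nat.
move: yN; rewrite -natr1.
by have [h1|h1] := leP (N%:R + 1) y => /= h2; apply/andP; split; lra.
Qed.

Section Independence.
Context d (T : measurableType d) (R : realType) (P : probability T R).

(** Both sides are linear in [f] and continuous for the uniform norm, and [f] is
    a uniform limit of step functions. *)
Lemma mean_comp_of_indic (X h : T -> R) (c : R) (f : R -> R) :
  measurable_fun setT X -> bounded_mfun h -> bounded_mfun f ->
  (forall A : set R, measurable A ->
     mean P (fun w => \1_A (X w) * h w) = c * mean P (fun w => \1_A (X w))) ->
  mean P (fun w => f (X w) * h w) = c * mean P (fun w => f (X w)).
Proof.
move=> mX bh [mf [M0 Mf0]] HA.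
pose M : R := `|M0| + 1.
have M_gt0 : 0 < M by rewrite ltr_wpDl.
have Mf x : - M <= f x <= M.
  by rewrite -ler_norml (le_trans (Mf0 x)) // (le_trans (ler_norm _)) // lerDl.
have [H [H0 Hh]] : exists H : R, 0 <= H /\ forall w, `|h w| <= H.
  have [H Hh] := bh.2; exists `|H|; split => // w.
  exact: le_trans (Hh w) (ler_norm _).
apply/eqP; rewrite -subr_eq0 -normr_le0; apply/ler_addgt0Pr => e e0; rewrite add0r.
(* [N] steps of height [t = 2 * M / N] leave an error of at most [C / N] *)
pose C := 2 * M * (H + `|c|).
pose N := (Num.truncn (C / e)).+1.
have N0 : 0 < N%:R :> R by rewrite ltr0n.
pose t := 2 * M / N%:R.
have t0 : 0 < t by rewrite divr_gt0 // mulr_gt0.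
pose y x := (f x + M) / t.
have my : measurable_fun setT y.
  by apply: measurable_funM => //; apply: measurable_funD.
pose A (a : 'I_N) := y @^-1` `[a.+1%:R, +oo[.
have mA a : measurable (A a).
  by rewrite /A -[X in measurable X]setTI; apply: my => //; exact: measurable_itv.
have AE a x : \1_(A a) x = (a.+1%:R <= y x)%R%:R :> R.
  rewrite indicE; congr (nat_of_bool _)%:R.
  by apply/idP/idP; rewrite inE /A /= in_itv /= andbT.
pose r x := y x - \sum_(a < N) \1_(A a) x.
have r01 x : 0 <= r x <= 1.
  rewrite /r; under eq_bigr do rewrite AE.
  apply: staircase; rewrite divr_ge0 /=; [|by have /andP[] := Mf x; lra|exact: ltW].
  rewrite ler_pdivrMr // /t mulrC divfK ?gt_eqF //.
  by have /andP[] := Mf x; lra.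
have bA a : bounded_mfun (\1_(A a) : R -> R) by exact: bounded_mfun_indic.
have br : bounded_mfun r.
  split; last by exists 1 => x; have /andP[r0 r1] := r01 x; rewrite ger0_norm.
  apply: measurable_funB => //; apply: measurable_sum => a; exact: (bA a).1.
have fE x : f x = - M + t * (\sum_(a < N) \1_(A a) x + r x).
  by rewrite /r addrCA subrr addr0 /y mulrC divfK ?gt_eqF // [RHS]addrC addrK.
have bfX (g : R -> R) : bounded_mfun g -> bounded_mfun (fun w => g (X w)).
  exact: bounded_mfun_comp.
have brX := bfX r br.
have bS : bounded_mfun (fun w => \sum_(a < N) \1_(A a) (X w) : R).
  by apply: bounded_mfun_sum => a _; exact: bfX _ (bA a).
have meanfX : mean P (fun w => f (X w)) =
    - M + t * (\sum_(a < N) mean P (fun w => \1_(A a) (X w)) + mean P (fun w => r (X w))).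
  under [X in mean P X]eq_fun do rewrite fE.
  rewrite meanD; [|exact: bounded_mfun_cst|]; last first.
    by apply: bounded_mfunM; [exact: bounded_mfun_cst|exact: bounded_mfunD].
  rewrite mean_cst meanZ; last exact: bounded_mfunD.
  rewrite meanD // mean_sum // => a _; exact: bfX _ (bA a).
have meanfXh : mean P (fun w => f (X w) * h w) =
    - M * mean P h + t * (\sum_(a < N) mean P (fun w => \1_(A a) (X w) * h w)
      + mean P (fun w => r (X w) * h w)).
  have bAh a : bounded_mfun (fun w => \1_(A a) (X w) * h w).
    by apply: bounded_mfunM => //; exact: bfX _ (bA a).
  have E w : f (X w) * h w =
      - M * h w + t * (\sum_(a < N) \1_(A a) (X w) * h w + r (X w) * h w).
    by rewrite fE -mulr_suml; ring.
  under [X in mean P X]eq_fun do rewrite E.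
  have bSh : bounded_mfun (fun w => \sum_(a < N) \1_(A a) (X w) * h w).
    by apply: bounded_mfun_sum => a _.
  have brh : bounded_mfun (fun w => r (X w) * h w) by exact: bounded_mfunM.
  rewrite meanD; [|by apply: bounded_mfunM => //; exact: bounded_mfun_cst|]; last first.
    by apply: bounded_mfunM; [exact: bounded_mfun_cst|exact: bounded_mfunD].
  by rewrite !meanZ ?meanD ?mean_sum //; exact: bounded_mfunD.
have meanh : mean P h = c.
  have := HA setT measurableT.
  under [X in mean P X]eq_fun do rewrite indicT mul1r.
  by under [X in _ * mean P X]eq_fun do rewrite indicT; rewrite mean_cst mulr1.
rewrite meanfX meanfXh meanh; under eq_bigr do rewrite HA //.
rewrite -mulr_sumr.
set S := \sum_(a < N) _.
set u := mean P (fun w => r (X w) * h w); set v := mean P (fun w => r (X w)).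
rewrite (_ : _ - _ = t * (u - c * v)); last by ring.
have u1 : `|u| <= H.
  apply: mean_norm_le; first exact: bounded_mfunM.
  move=> w; have /andP[r0 r1] := r01 (X w); rewrite normrM (ger0_norm r0).
  by rewrite (le_trans _ (Hh w)) // ler_piMl.
have v1 : `|v| <= 1.
  apply: mean_norm_le => // w; have /andP[r0 r1] := r01 (X w).
  by rewrite ger0_norm.
rewrite normrM (gtr0_norm t0).
apply: le_trans (_ : t * (H + `|c|) <= _).
  rewrite ler_pM2l // (le_trans (ler_normB _ _)) // lerD // normrM ler_piMr //.
rewrite /t mulrAC -/C ler_pdivrMr // -ler_pdivrMl // mulrC.
exact/ltW/truncnS_gt.
Qed.

Lemma mean_prod_indep (I : choiceType) (D : set I) (X : I -> {RV P >-> R}) (J : seq I)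
    (f : I -> R -> R) :
  mutually_independent D X -> uniq J -> {in J, forall i, D i} ->
  (forall i, bounded_mfun (f i)) ->
  mean P (fun w => \prod_(i <- J) f i (X i w)) =
  \prod_(i <- J) mean P (fun w => f i (X i w)).
Proof.
move=> indX uJ JD bf.
have mX i : measurable_fun setT (X i) by exact: measurable_funPT.
have mXA i (A : set R) : measurable A -> measurable (X i @^-1` A).
  by move=> mA; rewrite -[X in measurable X]setTI; exact: mX.
(* the factors outside [s] are indicators; [s] grows one index at a time *)
suff main (s : seq I) (g : I -> R -> R) : (forall i, bounded_mfun (g i)) ->
    (forall i, i \in J -> i \notin s -> exists2 A : set R, measurable A & g i = \1_A) ->
    mean P (fun w => \prod_(i <- J) g i (X i w)) =
    \prod_(i <- J) mean P (fun w => g i (X i w)).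
  by apply: (main J f bf) => i iJ; rewrite iJ.
elim: s g => [|i s IH] g bg gA.
  have /choice[A HA] : forall i, exists A, measurable A /\ (i \in J -> g i = \1_A).
    move=> i; have [/gA[]// A mA gi|] := boolP (i \in J); first by exists A.
    by exists set0; split=> //; exact: measurable0.
  have mA i : measurable (A i) by have [] := HA i.
  have {}gA i : i \in J -> g i = \1_(A i) by have [] := HA i.
  have JE : [set` [fset x in J]%fset] = [set` J].
    by apply/seteqP; split=> x /=; rewrite inE.
  have PA : P (\bigcap_(i in [set` J]) X i @^-1` A i) =
      (\prod_(i <- J) fine (P (X i @^-1` A i)))%:E.
    have := indX [fset x in J]%fset A _ mA; rewrite JE => -> //.
    rewrite -prodEFin (perm_big J) /=; last first.
      by apply: uniq_perm => // x; rewrite inE.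
    by apply: eq_bigr => i _; rewrite fineK // fin_num_measure //; exact: mXA.
  have E w : \prod_(i <- J) g i (X i w) = \1_(\bigcap_(i in [set` J]) X i @^-1` A i) w.
    rewrite indicE; case: (boolP (w \in _)); rewrite ?inE ?notin_setE => Hw.
      rewrite big1_seq // => i /andP[_ iJ]; rewrite gA // indicE.
      by rewrite mem_set //; exact: (Hw i iJ).
    have [i [iJ iA]] : exists i, i \in J /\ ~ (X i @^-1` A i) w.
      apply: contrapT => /forallNP H; apply: Hw => i iJ; apply: contrapT => iA.
      exact: (H i).
    by rewrite (bigD1_seq i) //= gA // indicE memNset // mul0r.
  under [X in mean P X]eq_fun do rewrite E.
  rewrite mean_indic; last first.
    by apply: fin_bigcap_measurable => // i _; exact: mXA.
  rewrite PA /=; apply: eq_big_seq => i iJ; rewrite gA //.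
  by rewrite -mean_indic //; exact: mXA.
have [iJ|iJ] := boolP (i \in J); last first.
  apply: IH => // j jJ js; apply: gA => //; rewrite inE negb_or js andbT.
  by apply: contraNneq iJ => <-.
rewrite [RHS](bigD1_seq i) //=; under [X in mean P X]eq_fun do rewrite (bigD1_seq i) //=.
rewrite mulrC; apply: mean_comp_of_indic => // [|A mA].
  by apply: bounded_mfun_prod => j _; exact: bounded_mfun_comp.
pose g' j := if j == i then \1_A else g j.
have bg' j : bounded_mfun (g' j).
  by rewrite /g'; case: ifP => // _; exact: bounded_mfun_indic.
have g'i : g' i = \1_A by rewrite /g' eqxx.
have g'j j : j != i -> g' j = g j by rewrite /g' => /negbTE ->.
have H : mean P (fun w => \prod_(j <- J) g' j (X j w)) =
    \prod_(j <- J) mean P (fun w => g' j (X j w)).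
  apply: IH => // j jJ js; have [->|ji] := eqVneq j i; first by exists A.
  by rewrite g'j //; apply: gA => //; rewrite inE negb_or ji.
transitivity (mean P (fun w => \prod_(j <- J) g' j (X j w))).
  congr (mean P _); apply/funext => w; rewrite [RHS](bigD1_seq i) //= g'i.
  by congr (_ * _); apply: eq_bigr => j ji; rewrite g'j.
rewrite H (bigD1_seq i) //= g'i mulrC.
by congr (_ * _); apply: eq_bigr => j ji; rewrite g'j.
Qed.

End Independence.

(** * Moments of the matrix and the tail bound *)

Lemma sym_extE (V : Type) n (a : 'I_n -> 'I_n -> V) i j :
  sym_ext a i j = a (edge i j).1 (edge i j).2.
Proof. by rewrite /sym_ext /edge; case: ifP. Qed.

Lemma mxtrace_even_ge0 (R : realFieldType) n (M : 'M[R]_n) k : M^T = M ->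
  0 <= \tr (M ^+ k.*2).
Proof.
move=> MT; rewrite -addnn exprD -{2}MT -trmxX.
apply: sumr_ge0 => i _; rewrite mxE; apply: sumr_ge0 => j _.
by rewrite mxE -expr2 sqr_ge0.
Qed.

Lemma mean_ae d (T : measurableType d) (R : realType) (P : probability T R)
    (f g : T -> R) :
  measurable_fun setT f -> measurable_fun setT g ->
  {ae P, forall w, f w = g w} -> mean P f = mean P g.
Proof.
move=> mf mg fg; congr fine; apply: ae_eq_integral => //; try exact/measurable_EFinP.
by apply: filterS fg => w -> _.
Qed.

Lemma probability_ae_eq d (T : measurableType d) (R : realType) (P : probability T R)
    (A B : set T) : measurable A -> measurable B ->
  {ae P, forall w, A w <-> B w} -> P A = P B.
Proof.
move=> mA mB AB; rewrite -(fineK (fin_num_measure P A mA)).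
rewrite -(fineK (fin_num_measure P B mB)).
congr EFin; rewrite -!mean_indic //; apply: mean_ae; try exact: measurable_indic.
apply: filterS AB => w [AB BA]; rewrite !indicE.
by have -> : (w \in A) = (w \in B) by apply/idP/idP => /set_mem ?; apply/mem_set; auto.
Qed.

Definition cutoff (R : realType) (K x : R) : R := if `|x| <= K then x else 0.

Lemma cutoff_id (R : realType) (K x : R) : `|x| <= K -> cutoff K x = x.
Proof. by rewrite /cutoff => ->. Qed.

Lemma cutoff_le (R : realType) (K x : R) : 0 <= K -> `|cutoff K x| <= K.
Proof. by rewrite /cutoff; case: ifP => // _; rewrite normr0. Qed.

Lemma bounded_cutoff (R : realType) (K : R) : 0 <= K -> bounded_mfun (cutoff K).
Proof.
move=> K0; split; last by exists K => x; exact: cutoff_le.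
rewrite (_ : cutoff K = fun x => x * \1_(`[- K, K]%classic) x).
  by apply: measurable_funM => //; exact: measurable_indic.
apply/funext => x; rewrite /cutoff indicE ler_norml.
case: ifPn => H; first by rewrite mem_set ?mulr1 //= in_itv.
by rewrite memNset ?mulr0 //= in_itv /=; exact/negP.
Qed.

Section Tail.
Context d (T : measurableType d) (R : realType) (P : probability T R) (n : nat).
Variables (b : 'I_n -> 'I_n -> {RV P >-> R}) (K s : R) (sigma : 'I_n -> 'I_n -> R).
Hypotheses (indb : mutually_independent
       [set ij : 'I_n * 'I_n | (ij.1 <= ij.2)%N] (fun ij : 'I_n * 'I_n => b ij.1 ij.2))
  (K0 : 0 < K) (s0 : 0 < s)
  (b_le : forall i j : 'I_n, (i <= j)%N -> {ae P, forall w, `|b i j w| <= K})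
  (b_mean : forall i j : 'I_n, (i <= j)%N -> ('E_P[b i j] = 0)%E)
  (b_var : forall i j : 'I_n, (i <= j)%N -> ('V_P[b i j] <= (sigma i j ^+ 2)%:E)%E)
  (row_le : forall i, \sum_j sym_ext sigma i j ^+ 2 <= s ^+ 2).

Let X (e : 'I_n * 'I_n) : {RV P >-> R} := b e.1 e.2.
Let sg (e : 'I_n * 'I_n) : R := sigma e.1 e.2.
Let Y (e : 'I_n * 'I_n) (w : T) : R := cutoff K (X e w).
Let q e m := `|mean P (fun w => Y e w ^+ m)|.

Let bY e : bounded_mfun (Y e).
Proof.
by apply: bounded_mfun_comp; [exact: measurable_funPT|exact/bounded_cutoff/ltW].
Qed.

Let Y_le e w : `|Y e w| <= K.
Proof. exact/cutoff_le/ltW. Qed.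

Let Y_ae e : ordered_pair e -> {ae P, forall w, Y e w = X e w}.
Proof. by move=> /b_le; apply: filterS => w; exact: cutoff_id. Qed.

Lemma mean_cutoff e : ordered_pair e -> mean P (Y e) = 0.
Proof.
move=> oe; rewrite (mean_ae (g := X e));
  [|exact: (bY e).1|exact: measurable_funPT|exact: Y_ae].
by have := b_mean oe; rewrite unlock /mean /Rintegral => ->.
Qed.

Lemma mean_cutoff_sqr e : ordered_pair e -> mean P (fun w => Y e w ^+ 2) <= sg e ^+ 2.
Proof.
move=> oe; rewrite -lee_fin EFin_mean; last exact: bounded_mfunX.
apply: le_trans (b_var oe).
rewrite /variance unlock b_mean // unlock.
rewrite le_eqVlt; apply/orP; left; apply/eqP.
apply: ae_eq_integral => //.
- by apply/measurable_EFinP; apply: measurable_funX; exact: (bY e).1.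
- apply/measurable_EFinP; apply: measurable_funM; apply: measurable_funB => //;
    exact: measurable_funPT.
- by apply: filterS (Y_ae oe) => w -> _ /=; rewrite expr2 fctE /= subr0.
Qed.

(** The cut-off variables are functions of independent variables, and their
    moments satisfy the hypotheses of [moment_le_walk_weight]. *)
Lemma mean_path_le v p :
  mean P (fun w => path_prod (Y ^~ w) v p) <=
  walk_weight s K sg v [set v]%SET finset.set0 p.
Proof.
under [X in mean P X]eq_fun do rewrite path_prodE -big_filter.
have := @mean_prod_indep _ T R P _ _ X
  [seq e <- index_enum _ | ordered_pair e]
  (fun e x => cutoff K x ^+ edge_count v p e) indb.
move=> ->; first last.
- by move=> e; apply: bounded_mfunX; exact/bounded_cutoff/ltW.
- by move=> e; rewrite mem_filter => /andP[].
- by apply: filter_uniq; exact: index_enum_uniq.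
rewrite big_filter (le_trans (ler_norm _)) // normr_prod.
apply: (moment_le_walk_weight (q := q)) => //; first by move=> e m; exact: normr_ge0.
- move=> e m oe; apply: mean_norm_le; first exact: bounded_mfunX.
  by move=> w; rewrite normrX lerXn2r ?nnegrE ?Y_le ?(ltW K0).
- move=> e oe; rewrite /q; under [X in mean P X]eq_fun do rewrite expr1.
  by rewrite mean_cutoff // normr0.
- move=> e m oe; rewrite /q.
  have bYX k : bounded_mfun (fun w => Y e w ^+ k) by exact: bounded_mfunX.
  have bKY : bounded_mfun (fun w => K ^+ m * Y e w ^+ 2).
    by apply: bounded_mfunM => //; exact: bounded_mfun_cst.
  apply: le_trans (_ : K ^+ m * mean P (fun w => Y e w ^+ 2) <= _); last first.
    by rewrite mulrC ler_wpM2r ?exprn_ge0 ?mean_cutoff_sqr // ltW.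
  rewrite -meanZ //.
  have Hw w : `|Y e w ^+ m.+2| <= K ^+ m * Y e w ^+ 2.
    rewrite normrX -addn2 exprD real_normK ?num_real //.
    by rewrite ler_wpM2r ?sqr_ge0 // lerXn2r ?nnegrE ?Y_le ?(ltW K0).
  rewrite ler_norml; apply/andP; split; last first.
    by apply: mean_le => // w; exact: le_trans (ler_norm _) (Hw w).
  rewrite -mulN1r -meanZ //; apply: mean_le => //.
    by apply: bounded_mfunM => //; exact: bounded_mfun_cst.
  by move=> w; rewrite mulN1r lerNl (le_trans _ (Hw w)) // -normrN ler_norm.
Qed.

Let M (w : T) : 'M[R]_n := \matrix_(i, j) Y (edge i j) w.

(** The trace is a sum over closed walks; the weights are summed over all walks,
    since the majorant holds for this larger sum. *)
Lemma mean_trace_le k : K * k%:R ^+ 2 <= s ->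
  bounded_mfun (fun w => \tr (M w ^+ k)) /\
  mean P (fun w => \tr (M w ^+ k)) <= n%:R * (4 * (2 * s) ^+ k).
Proof.
move=> Kk.
have trE w : \tr (M w ^+ k) =
    \sum_v \sum_(p <- walks n k | last v p == v) path_prod (Y ^~ w) v p.
  by apply: eq_bigr => v _; exact: (mxpow_walks (Y ^~ w)).
have bp v p : bounded_mfun (fun w => path_prod (Y ^~ w) v p).
  elim: p v => [|u p IH] v /=; first exact: bounded_mfun_cst.
  exact: bounded_mfunM.
have bv v : bounded_mfun
    (fun w => \sum_(p <- walks n k | last v p == v) path_prod (Y ^~ w) v p).
  exact: bounded_mfun_sum.
under eq_fun do rewrite trE; split; first exact: bounded_mfun_sum.
rewrite mean_sum //; under eq_bigr do rewrite mean_sum //.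
apply: le_trans (_ : \sum_(v < n) 4 * (2 * s) ^+ k <= _); last first.
  by rewrite sumr_const card_ord -[leLHS]mulr_natl.
apply: ler_sum => v _.
apply: le_trans (sum_walk_weight_start (sg := sg) s0 (ltW K0) Kk _ v); last first.
  by move=> i; have := row_le i; under eq_bigr do rewrite sym_extE.
rewrite big_mkcond /=; apply: ler_sum => p _; case: ifP => _; first exact: mean_path_le.
by apply: walk_weight_ge0 => //; exact: ltW.
Qed.

(** Markov's inequality for the trace, in the form of the pointwise bound of the
    indicator of the event by [1 - \tr (M ^+ k.*2) / t ^+ k.*2]. The measure of a
    set means nothing unless the set is measurable, hence the first conclusion. *)
Lemma spectral_norm_tail k (t : R) : K * k.*2%:R ^+ 2 <= s -> 0 < t ->
  measurable [set w | spectral_norm (sym_mx b w) <= t] /\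
  ((1 - n%:R * (4 * (2 * s) ^+ k.*2) / t ^+ k.*2)%:E <=
    P [set w | (spectral_norm (sym_mx b w) <= t)%R])%E.
Proof.
move=> Kk t0.
have [btr mtr] := mean_trace_le Kk.
have MT w : (M w)^T = M w by apply/matrixP => i j; rewrite !mxE edgeC.
have BT w : (sym_mx b w)^T = sym_mx b w.
  by apply/matrixP => i j; rewrite !mxE !sym_extE edgeC.
have mB : measurable [set w | spectral_norm (sym_mx b w) <= t].
  apply: measurable_spectral_norm_le => //; first exact: ltW.
  move=> i j; under eq_fun do rewrite mxE sym_extE; exact: measurable_funPT.
have mM : measurable [set w | spectral_norm (M w) <= t].
  apply: measurable_spectral_norm_le => //; first exact: ltW.
  move=> i j; under eq_fun do rewrite mxE; exact: (bY _).1.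
split => //.
have MB : {ae P, forall w, M w = sym_mx b w}.
  have : {ae P, forall w, forall e : 'I_n * 'I_n, ordered_pair e -> Y e w = X e w}.
    apply: filter_forall => e; case: (boolP (ordered_pair e)) => oe.
      by apply: filterS (Y_ae oe) => w.
    by apply: filterE.
  apply: filterS => w H; apply/matrixP => i j; rewrite !mxE sym_extE H //.
  exact: edge_ordered.
set A := [set w | spectral_norm (sym_mx b w) <= t] in mB *.
set A' := [set w | spectral_norm (M w) <= t] in mM *.
have -> : P A = P A'.
  by apply: probability_ae_eq => //; apply: filterS MB => w; rewrite /A /A' /= => ->.
rewrite -(fineK (fin_num_measure P A' mM)) -(mean_indic P mM) lee_fin.
have bA : bounded_mfun (\1_A' : T -> R) by exact: bounded_mfun_indic.
have tk : 0 < t ^+ k.*2 by exact: exprn_gt0.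
have bg : bounded_mfun (fun w => (- (t ^+ k.*2)^-1) * \tr (M w ^+ k.*2)).
  by apply: bounded_mfunM => //; exact: bounded_mfun_cst.
apply: le_trans (_ : mean P (fun w => 1 + (- (t ^+ k.*2)^-1) * \tr (M w ^+ k.*2)) <= _).
  rewrite meanD //; last exact: bounded_mfun_cst.
  rewrite mean_cst meanZ // lerD2l mulNr lerN2 mulrC ler_pM2r ?invr_gt0 //.
apply: mean_le => //; first by apply: bounded_mfunD => //; exact: bounded_mfun_cst.
move=> w; rewrite indicE.
have tr0 := mxtrace_even_ge0 k (MT w).
case: (boolP (w \in A')) => /=.
  by move=> _; rewrite gerDl mulNr oppr_le0 mulr_ge0 // invr_ge0 ltW.
rewrite notin_setE /A' /= => /negP; rewrite -ltNge => tM.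
rewrite mulNr subr_le0 mulrC ler_pdivlMr // mul1r.
have [s1 sM ts] := lt_spectral_norm (ltW t0) tM.
apply: le_trans (singular_value_trace k (MT w) sM).
by rewrite lerXn2r ?nnegrE ?ltW // (lt_trans t0).
Qed.
End Tail.

(** * Choice of the order of the moment *)

Lemma expR_half_le (R : realType) (x : R) : 0 <= x <= 1 -> expR (x / 2) <= 1 + x.
Proof.
move=> /andP[x0 x1]; have h : 1 - x / 2 <= (expR (x / 2))^-1.
  by rewrite -expRN; exact: expR_ge1Dx.
have e0 := expR_gt0 (x / 2).
have : (1 - x / 2) * expR (x / 2) <= 1 by rewrite -ler_pdivlMr // mul1r.
have : 1 <= (1 + x) * (1 - x / 2) by nra.
have : 0 < 1 - x / 2 by lra.
nra.
Qed.

Lemma ln_ge_half (R : realType) n : (1 < n)%N -> 1 / 2 <= ln (n%:R : R).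
Proof.
move=> n1; have n0 : 0 < n%:R :> R by rewrite ltr0n (ltn_trans _ n1).
rewrite -ler_expR lnK ?posrE //.
apply: le_trans (@expR_half_le R 1 _) _; first by rewrite ler01 lexx.
by rewrite -[X in X <= _]/(2%:R) ler_nat.
Qed.

Lemma moment_order (R : realType) (x : R) : 4 <= x ->
  exists k, x / 2 <= k.*2%:R <= x.
Proof.
move=> x4; exists (Num.truncn (x / 2)).
have x0 : 0 <= x / 2 by lra.
have /andP[] := truncn_itv x0; move: (Num.truncn _) => k h1 h2.
by rewrite -muln2 natrM; move: h2; rewrite -(natr1 k) => h2; apply/andP; split; lra.
Qed.

(** Here [r] is the square root of [K], [y] the fourth root of Delta and [L] is
    [ln n]. The order [k.*2] lies between [x / 2] and [x = y / r]. Writing the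
    right-hand side as [(2 * y ^+ 2 * (1 + e)) ^+ k.*2] with [e = 8 * L / x <= 1],
    the factor [(1 + e) ^+ k.*2] is at least
    [expR (k.*2 * e / 2) >= expR (2 * L)]. *)
Lemma tail_numerics (R : realType) (L r y : R) : 1 / 2 <= L -> 0 < r -> 0 < y ->
  8 * r * L <= y ->
  exists k, r ^+ 2 * k.*2%:R ^+ 2 <= y ^+ 2 /\
    (2 * y ^+ 2) ^+ k.*2 * expR L ^+ 2 <= (2 * y ^+ 2 + 16 * r * y * L) ^+ k.*2.
Proof.
move=> L2 r0 y0 ry; pose x := y / r.
have yx : y = x * r by rewrite /x divfK // gt_eqF.
have x8 : 8 * L <= x by rewrite /x ler_pdivlMr //; lra.
have x0 : 0 < x by rewrite divr_gt0.
have [|k /andP[k1 k2]] := @moment_order R x; first by lra.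
exists k; split.
  rewrite yx exprMn mulrC ler_wpM2r ?sqr_ge0 //.
  by rewrite lerXn2r ?nnegrE // ltW.
pose e := 8 * L / x.
have e01 : 0 <= e <= 1.
  by rewrite divr_ge0 ?ler_pdivrMr ?mul1r // ?ltW //; lra.
rewrite (_ : 2 * y ^+ 2 + _ = (2 * y ^+ 2) * (1 + e)); last first.
  by rewrite /e yx; field; rewrite gt_eqF.
rewrite [leRHS]exprMn ler_pM2l; last by rewrite exprn_gt0 // mulr_gt0 // exprn_gt0.
apply: le_trans (_ : expR (e / 2) ^+ k.*2 <= _); last first.
  rewrite lerXn2r ?nnegrE ?expR_ge0 ?expR_half_le //.
  by have /andP[] := e01; lra.
rewrite -!expRM_natl ler_expR.
rewrite (_ : e / 2 = 4 * L / x); last by rewrite /e; field; rewrite gt_eqF.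
rewrite mulrA ler_pdivlMr //; nra.
Qed.

Lemma spectral_norm_tail_explicit d (T : measurableType d) (R : realType)
    (P : probability T R) n (b : 'I_n -> 'I_n -> {RV P >-> R}) (K : R)
    (sigma : 'I_n -> 'I_n -> R) :
  (1 < n)%N ->
  mutually_independent [set ij : 'I_n * 'I_n | (ij.1 <= ij.2)%N]
    (fun ij : 'I_n * 'I_n => b ij.1 ij.2) ->
  0 < K ->
  (forall i j : 'I_n, (i <= j)%N ->
     [/\ 0 <= sigma i j,
         {ae P, forall w, `|b i j w| <= K},
         ('E_P[b i j] = 0)%E &
         ('V_P[b i j] <= (sigma i j ^+ 2)%:E)%E]) ->
  8 ^+ 4 * K ^+ 2 * ln (n%:R) ^+ 4 <= max_row_variance sigma ->
  ((1 - 4 * n%:R^-1)%:E <= P [set w | (spectral_norm (sym_mx b w) <=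
              2 * Num.sqrt (max_row_variance sigma) +
              16 * Num.sqrt K * max_row_variance sigma `^ (4^-1) *
              ln (n%:R))%R] <= 1)%E.
Proof.
move=> n1 ind K0 H HD; set D := max_row_variance sigma in HD *.
set L := ln n%:R in HD *.
have L2 : 1 / 2 <= L by exact: ln_ge_half.
have L0 : 0 < L by apply: lt_le_trans L2; rewrite divr_gt0.
have D0 : 0 < D.
  by apply: lt_le_trans HD; rewrite !mulr_gt0 ?exprn_gt0.
pose y := D `^ (4^-1); pose r := Num.sqrt K.
have y0 : 0 < y by exact: powR_gt0.
have r0 : 0 < r by rewrite sqrtr_gt0.
have rK : r ^+ 2 = K by rewrite sqr_sqrtr // ltW.
have y4 : y ^+ 4 = D.
  by rewrite -powR_mulrn ?(ltW y0) // -powRrM mulVf ?powRr1 // ltW.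
have yD : Num.sqrt D = y ^+ 2.
  by rewrite -y4 (exprM y 2 2) sqrtr_sqr ger0_norm // sqr_ge0.
have [|k [Kk tk]] := @tail_numerics R L r y L2 r0 y0.
  rewrite -(@ler_pXn2r _ 4) ?nnegrE ?(ltW y0) // ?y4; last first.
    by rewrite !mulr_ge0 ?(ltW r0) ?(ltW L0).
  apply: le_trans HD; rewrite -rK -exprM !exprMn mulrAC.
  by rewrite le_eqVlt eqxx.
rewrite yD -/y -/r.
have t0 : 0 < 2 * y ^+ 2 + 16 * r * y * L.
  by rewrite addr_gt0 // !mulr_gt0 ?exprn_gt0.
have row i : \sum_j sym_ext sigma i j ^+ 2 <= (y ^+ 2) ^+ 2.
  by rewrite -exprM y4 /D /max_row_variance; apply: le_bigmax_cond.
have [mA PA] := @spectral_norm_tail _ T R P n b K (y ^+ 2) sigma ind K0 (exprn_gt0 2 y0)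
   (fun i j ij => let: And4 _ h _ _ := H i j ij in h)
   (fun i j ij => let: And4 _ _ h _ := H i j ij in h)
   (fun i j ij => let: And4 _ _ _ h := H i j ij in h) row k
   (2 * y ^+ 2 + 16 * r * y * L) (eq_ind _ (fun K' => K' * _ <= _) Kk _ rK) t0.
rewrite probability_le1 // andbT; apply: le_trans PA.
rewrite lee_fin lerD2l lerN2 ler_pdivrMr ?exprn_gt0 //.
have n0 : 0 < n%:R :> R by rewrite ltr0n (ltn_trans _ n1).
have eL : expR L = n%:R by rewrite /L lnK ?posrE.
rewrite (_ : n%:R * _ = 4 * n%:R^-1 * ((2 * y ^+ 2) ^+ k.*2 * n%:R ^+ 2)); last first.
  by field; rewrite gt_eqF.
by rewrite ler_wpM2l ?mulr_ge0 ?invr_ge0 ?(ltW n0) // -eL.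
Qed.

Theorem theorem6 (R : realType) :
  exists C C' : R,
  forall (d : nat -> measure_display)
         (T : forall n : nat, measurableType (d n))
         (P : forall n : nat, probability (T n) R)
         (b : forall n : nat, 'I_n -> 'I_n -> {RV (P n) >-> R})
         (K : nat -> R)
         (sigma : forall n : nat, 'I_n -> 'I_n -> R),
  (forall n : nat,
     mutually_independent
       [set ij : 'I_n * 'I_n | (ij.1 <= ij.2)%N]
       (fun ij : 'I_n * 'I_n => b n ij.1 ij.2)) ->
  (forall n : nat, 0 < K n) ->
  (forall (n : nat) (i j : 'I_n), (i <= j)%N ->
     [/\ 0 <= sigma n i j,
         {ae P n, forall w, `|b n i j w| <= K n},
         ('E_(P n)[b n i j] = 0)%E &
         ('V_(P n)[b n i j] <= (sigma n i j ^+ 2)%:E)%E]) ->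
  (forall n : nat,
     C' * K n ^+ 2 * ln (n%:R) ^+ 4 <= max_row_variance (sigma n)) ->
  (fun n : nat =>
     P n [set w : T n |
            spectral_norm (sym_mx (b n) w) <=
              2 * Num.sqrt (max_row_variance (sigma n)) +
              C * Num.sqrt (K n) * max_row_variance (sigma n) `^ (4^-1) *
              ln (n%:R)])
    @ \oo --> 1%:E.
Proof.
exists 16, (8 ^+ 4) => d T P b K sigma ind K0 H HD.
apply: (@squeeze_cvge _ _ _ _ (fun n => (1 - 4 * n%:R^-1)%:E) _ (fun=> 1%:E)).
- near=> n; apply: spectral_norm_tail_explicit => //; last exact: H.
  by near: n; exact: nbhs_infty_gt.
- apply: cvg_EFin; first exact: nearW.
  rewrite -[X in _ --> X]subr0 -[X in _ --> _ - X](mulr0 4).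
  apply: cvgB; first exact: cvg_cst.
  apply: cvgM; first exact: cvg_cst.
  rewrite -(cvg_shiftS _); exact: cvg_harmonic.
- exact: cvg_cst.
Unshelve. all: by end_near. Qed.
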